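(* Let $p\ge 2$ and $\varphi\in\mathbb{C}^{p-1}\setminus\Omega_1$. Then the Lie algebra $\operatorname{Der}(F_\varphi)$ is solvable of derived length $3$ and is complete, i.e. it has trivial center and every derivation of it is inner. Moreover, for any $\varphi,\varphi'\in\mathbb{C}^{p-1}\setminus\Omega_1$ one has $\operatorname{Der}(F_\varphi)\cong\operatorname{Der}(F_{\varphi'})$.
   Context: Let $p\ge 2$ and $\varphi=(\varphi_1,\dots,\varphi_{p-1})\in\mathbb{C}^{p-1}$. $F_\varphi$ denotes the $2p$-dimensional complex Lie algebra with basis $X_1,\dots,X_{2p}$ whose nonzero brackets (up to antisymmetry) are $[X_1,X_2]=X_1$, $[X_2,X_{2k+1}]=\varphi_kX_{2k+1}$, $[X_2,X_{2k+2}]=-(1+\varphi_k)X_{2k+2}$, $[X_{2k+1},X_{2k+2}]=X_1$ for $1\le k\le p-1$. $\Omega_1\subset\mathbb{C}^{p-1}$ is the union of the hyperplanes $\{1+\varphi_i+\varphi_j=0\}$, $\{2+\varphi_i+\varphi_j=0\}$ ($1\le i,j\le p-1$), $\{\varphi_i-\varphi_j=0\}$ ($1\le i\ne j\le p-1$), $\{\varphi_i=0\}$, $\{\varphi_i+1=0\}$, $\{2\varphi_i+1=0\}$ ($1\le i\le p-1$). $\operatorname{Der}(\mathfrak g)$ is the Lie algebra of derivations of $\mathfrak g$ with the commutator bracket. *)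

(* Defs.v *)
From HB Require Import structures.
From mathcomp Require Import all_boot all_order all_algebra.
From mathcomp Require Import complex.
From mathcomp Require Import reals.
Set Implicit Arguments. Unset Strict Implicit. Unset Printing Implicit Defensive.
Import Order.TTheory GRing.Theory Num.Theory.
Local Open Scope ring_scope.

Section LieGen.
Variable F : fieldType.

Definition lieb n (A B : 'M[F]_n) : 'M[F]_n := A *m B - B *m A.

Fixpoint derived n (L : 'M[F]_n -> Prop) (k : nat) : 'M[F]_n -> Prop :=
  match k with
  | 0 => L
  | k'.+1 => fun x => exists s : seq ('M[F]_n * 'M[F]_n),
      (forall ab, ab \in s -> derived L k' ab.1 /\ derived L k' ab.2) /\
      x = \sum_(ab <- s) lieb ab.1 ab.2
  end.

Definition lie_solvable n (L : 'M[F]_n -> Prop) : Prop :=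
  exists k, forall x, derived L k x -> x = 0.

(* derived length exactly k (k >= 1): L^(k) = 0 and L^(k-1) <> 0 *)
Definition derived_length n (L : 'M[F]_n -> Prop) (k : nat) : Prop :=
  (forall x, derived L k x -> x = 0) /\ (exists x, derived L k.-1 x /\ x <> 0).

Definition trivial_center n (L : 'M[F]_n -> Prop) : Prop :=
  forall z, L z -> (forall x, L x -> lieb z x = 0) -> z = 0.

Definition lie_derivation n (L : 'M[F]_n -> Prop) (f : 'M[F]_n -> 'M[F]_n) : Prop :=
  [/\ (forall x, L x -> L (f x)),
      (forall a x y, L x -> L y -> f (a *: x + y) = a *: f x + f y) &
      (forall x y, L x -> L y -> f (lieb x y) = lieb (f x) y + lieb x (f y))].

Definition all_derivations_inner n (L : 'M[F]_n -> Prop) : Prop :=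
  forall f, lie_derivation L f -> exists2 z, L z & forall x, L x -> f x = lieb z x.

Definition lie_complete n (L : 'M[F]_n -> Prop) : Prop :=
  trivial_center L /\ all_derivations_inner L.

Definition lie_isomorphic n1 n2 (L1 : 'M[F]_n1 -> Prop) (L2 : 'M[F]_n2 -> Prop) : Prop :=
  exists (f : 'M[F]_n1 -> 'M[F]_n2) (g : 'M[F]_n2 -> 'M[F]_n1),
    [/\ (forall x, L1 x -> L2 (f x)) /\ (forall y, L2 y -> L1 (g y)),
        (forall x, L1 x -> g (f x) = x),
        (forall y, L2 y -> f (g y) = y),
        (forall a x y, L1 x -> L1 y -> f (a *: x + y) = a *: f x + f y) &
        (forall x y, L1 x -> L1 y -> f (lieb x y) = lieb (f x) (f y))].

Definition Der n (br : 'cV[F]_n -> 'cV[F]_n -> 'cV[F]_n) : 'M[F]_n -> Prop :=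
  fun D => forall x y, D *m br x y = br (D *m x) y + br x (D *m y).

End LieGen.

Section Fphi.
Variable R : realType.
Local Notation C := R[i].

(* standard basis vector with 0-based index a; X_{a+1} of the paper *)
Definition ev n (a : nat) : 'cV[C]_n := \col_(i < n) (val i == a)%:R.

(* phik phi k = phi_{k+1} of the paper (phi indexed 1..p-1, here 0..p-2) *)
Definition phik m (phi : 'I_m -> C) (k : nat) : C :=
  if insub k is Some i then phi i else 0.

(* coefficient for [X_2, X_{b+1}] : X_{2k+1} (b = 2k) -> phi_k, X_{2k+2} (b = 2k+1) -> -(1+phi_k) *)
Definition wt m (phi : 'I_m -> C) (b : nat) : C :=
  let f := phik phi (b./2).-1 in if odd b then - (1 + f) else f.

(* bracket [X_{a+1}, X_{b+1}] of basis vectors (0-based indices a, b < n = 2p) *)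
Definition Fbas m n (phi : 'I_m -> C) (a b : nat) : 'cV[C]_n :=
  if (a == 0) && (b == 1) then ev n 0
  else if (a == 1) && (b == 0) then - ev n 0
  else if (a == 1) && (2 <= b)%N then wt phi b *: ev n b
  else if (b == 1) && (2 <= a)%N then - (wt phi a *: ev n a)
  else if [&& (2 <= a)%N, ~~ odd a & b == a.+1] then ev n 0
  else if [&& (2 <= b)%N, ~~ odd b & a == b.+1] then - ev n 0
  else 0.

Definition Fbr p (phi : 'I_p.-1 -> C) (x y : 'cV[C]_(2 * p)) : 'cV[C]_(2 * p) :=
  \sum_(i < 2 * p) \sum_(j < 2 * p) (x i 0 * y j 0) *: Fbas (2 * p) phi i j.

Definition inOmega1 m (phi : 'I_m -> C) : Prop :=
  (exists i j, 1 + phi i + phi j = 0) \/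
  (exists i j, 2 + phi i + phi j = 0) \/
  (exists i j, i != j /\ phi i - phi j = 0) \/
  (exists i, phi i = 0) \/
  (exists i, phi i + 1 = 0) \/
  (exists i, 2 * phi i + 1 = 0).

End Fphi.

(* Main.v *)
Require Import Defs.
From HB Require Import structures.
From mathcomp Require Import all_boot all_order all_algebra.
From mathcomp Require Import complex reals.
From mathcomp Require Import boolp ring zify.
Import GRing.Theory Num.Theory.
Local Open Scope ring_scope.

(** Off [Omega_1] the eigenvalues of [ad X_2] are pairwise distinct, so modulo
    [ad X_2]-eigenvectors of nonzero eigenvalue, which are inner, every derivation
    of [F_phi] is diagonal.  Hence [Der F_phi = T + ad H], where [H] is the
    Heisenberg nilradical and [T] a maximal torus of diagonal derivations, and the
    bracket of [T + ad H] does not involve [phi].  The derived series is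
    [ad H], [C ad X_1], [0].  For completeness, a derivation of [T + ad H] can be
    corrected by an element of [ad H] so as to map [ad X_2] into [T]; it then kills
    [ad X_2] and is diagonal on [H], with eigenvalues realised by an element of [T]. *)

(** * Derivations of a one-dimensional extension of a Heisenberg algebra *)

Section TorusHeisenberg.
Set Implicit Arguments.
Unset Strict Implicit.

(** Reduces a goal to a known equation and a polynomial identity that [ring] can check. *)
Lemma eq_of_subr_eq (V : zmodType) (a b c d : V) : a = b -> c - d = a - b -> c = d.
Proof. by move=> ->; rewrite subrr => /subr0_eq. Qed.

(* [z] is the index of the central vector [X_1] of [H], [u] that of [X_2], and [sg]
   exchanges [X_{2k+1}] and [X_{2k+2}]; what [sg] does on [{z, u}] is irrelevant, since
   [s] vanishes there. *)
Variables (F : fieldType) (n : nat) (z u : 'I_n).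
Variables (sg : 'I_n -> 'I_n) (s : 'I_n -> F).
Hypotheses (zu : z != u) (sgK : involutive sg).
Hypothesis s_sg : forall j, s (sg j) = - s j.
Hypothesis s_eq0 : forall j, (s j == 0) = (j == z) || (j == u).

Implicit Types (w d h k x y : 'cV[F]_n) (D : 'M[F]_n) (i j l : 'I_n).

(** The alternating form of the Heisenberg bracket: for [x], [y] in [H] the bracket is [pairing x y]
    times the central vector. *)
Definition pairing x y : F := \sum_l s l * x l 0 * y (sg l) 0.

Definition hadamard d h : 'cV[F]_n := \col_i (d i 0 * h i 0).

Definition unitv i : 'cV[F]_n := \col_j (j == i)%:R.

(* [w] is the diagonal of [ad X_2]. *)
Definition weight_br w x y : 'cV[F]_n :=
  \col_i (w i 0 * (x u 0 * y i 0 - x i 0 * y u 0) + (i == z)%:R * pairing x y).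

(** The conditions for a diagonal matrix to respect [[X_2, X_1] = - X_1] and [[X_j, X_{sg j}] = s_j
    X_1]. *)
Definition torus d := d u 0 = 0 /\ forall j, s j != 0 -> d j 0 + d (sg j) 0 = d z 0.

(** [torus w] is the Jacobi identity for [X_2] and a pair of partners; injectivity says that
    [ad X_2] has simple spectrum. *)
Definition regular w := [/\ torus w, w z 0 = -1 & injective (fun i => w i 0)].

(* The matrix of [diag d + ad h]. *)
Definition der_mx w d h : 'M[F]_n := \matrix_(i, j)
  ((i == j)%:R * d i 0 - (j == u)%:R * (w i 0 * h i 0)
   + (i == z)%:R * (s (sg j) * h (sg j) 0)).

Definition torus_part D : 'cV[F]_n := \col_i D i i.
(* [D X_2 = - [X_2, h]] recovers [h]; the entry at [u] is [0] because [w u 0 = 0]. *)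
Definition nil_part w D : 'cV[F]_n := \col_i (- D i u / w i 0).

(** * Identities for the pairing, the matrices [der_mx] and the torus *)

Lemma s_z : s z = 0.
Proof. by apply/eqP; rewrite s_eq0 eqxx. Qed.

Lemma s_u : s u = 0.
Proof. by apply/eqP; rewrite s_eq0 eqxx orbT. Qed.

Lemma s_sgz : s (sg z) = 0. Proof. by rewrite s_sg s_z oppr0. Qed.
Lemma s_sgu : s (sg u) = 0. Proof. by rewrite s_sg s_u oppr0. Qed.

Lemma pairing_unitr h i : pairing h (unitv i) = s (sg i) * h (sg i) 0.
Proof.
rewrite /pairing (bigD1 (sg i)) //= mxE sgK eqxx mulr1 big1 ?addr0 // => l ne.
rewrite mxE; case: eqP => [e|_]; last by rewrite mulr0.
by rewrite -e sgK eqxx in ne.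
Qed.

Lemma pairing_anti x y : pairing y x = - pairing x y.
Proof.
rewrite /pairing (reindex_inj (inv_inj sgK)) /= -sumrN; apply: eq_bigr => l _.
by rewrite sgK s_sg; ring.
Qed.

Lemma pairing_unitl h i : pairing (unitv i) h = s i * h (sg i) 0.
Proof. by rewrite pairing_anti pairing_unitr s_sg; ring. Qed.

Lemma der_mx_act w d h x i : (der_mx w d h *m x) i 0 =
  d i 0 * x i 0 - w i 0 * h i 0 * x u 0 + (i == z)%:R * pairing h x.
Proof.
rewrite mxE; under eq_bigr => j _ do rewrite mxE mulrDl mulrBl.
rewrite big_split /= sumrB; congr (_ - _ + _).
- rewrite (bigD1 i) //= eqxx mul1r big1 ?addr0 // => j ne.
  by rewrite eq_sym (negPf ne) !mul0r.
- rewrite (bigD1 u) //= eqxx mul1r big1 ?addr0 // => j ne.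
  by rewrite (negPf ne) !mul0r.
- rewrite /pairing mulr_sumr [RHS](reindex_inj (inv_inj sgK)) /=.
  by apply: eq_bigr => j _; rewrite sgK; ring.
Qed.

Lemma der_mx_linear w a d h d' h' :
  der_mx w (a *: d + d') (a *: h + h') = a *: der_mx w d h + der_mx w d' h'.
Proof. by apply/matrixP=> i j; rewrite !mxE; ring. Qed.

Lemma der_mx00 w : der_mx w 0 0 = 0.
Proof. by apply/matrixP=> i j; rewrite !mxE; ring. Qed.

Lemma der_mxD w d h d' h' : der_mx w d h + der_mx w d' h' = der_mx w (d + d') (h + h').
Proof. by apply/matrixP=> i j; rewrite !mxE; ring. Qed.

Lemma der_mxZ w a d h : a *: der_mx w d h = der_mx w (a *: d) (a *: h).
Proof. by apply/matrixP=> i j; rewrite !mxE; ring. Qed.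

Lemma torus0 : torus 0.
Proof. by split=> [|j _]; rewrite !mxE ?addr0. Qed.

Lemma torus_linear a d d' : torus d -> torus d' -> torus (a *: d + d').
Proof.
move=> [du dp] [du' dp']; split; first by rewrite !mxE du du'; ring.
by move=> j sj; rewrite !mxE -(dp j sj) -(dp' j sj); ring.
Qed.

Lemma regular_neq0 w i : regular w -> i != u -> w i 0 != 0.
Proof. by case=> -[wu _] _ inj; apply: contraNneq => e; apply/eqP/inj; rewrite e wu. Qed.

Lemma sign_neq0 i : i != z -> i != u -> s i != 0.
Proof. by move=> iz iu; rewrite s_eq0 negb_or iz. Qed.

Lemma sign_support j : s j != 0 -> (j != z) * (j != u).
Proof. by rewrite s_eq0 negb_or => /andP[]. Qed.

Lemma s_sg_neq0 j : s j != 0 -> s (sg j) != 0.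
Proof. by rewrite s_sg oppr_eq0. Qed.

(** [ad h] has zero diagonal: its entries at [u] and [z] carry the factors [h u 0] and
    [s (sg z)]. *)
Lemma torus_part_der_mx w d h : h u 0 = 0 -> torus_part (der_mx w d h) = d.
Proof.
move=> hu; apply/matrixP=> i j; rewrite ord1 !mxE eqxx mul1r.
have -> : (i == u)%:R * (w i 0 * h i 0) = 0.
  by case: eqP => [->|_]; rewrite ?hu ?mul0r ?mulr0.
by case: eqP => [->|_] /=; rewrite ?s_sgz; ring.
Qed.

Lemma nil_part_der_mx w d h : regular w -> d u 0 = 0 -> h u 0 = 0 ->
  nil_part w (der_mx w d h) = h.
Proof.
move=> rw du hu; apply/matrixP=> i j; rewrite ord1 !mxE s_sgu eqxx.
case: (eqVneq i u) => [->|iu] /=.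
  by rewrite hu du (_ : w u 0 = 0) ?invr0; [ring|case: rw => -[]].
by have := regular_neq0 rw iu => w0; field.
Qed.

Lemma nil_part_u w D : regular w -> nil_part w D u 0 = 0.
Proof. by case=> -[wu _] _ _; rewrite mxE wu invr0 mulr0. Qed.

(** Only the coordinate [z] needs more than [ring]: there the torus conditions on [d] and on [w]
    both enter. *)
Lemma der_mx_Der w d h : regular w -> torus d -> h u 0 = 0 ->
  Der (weight_br w) (der_mx w d h).
Proof.
move=> [[wu wp] wz _] [du dp] hu x y.
have act0 (v : 'cV[F]_n) : (der_mx w d h *m v) u 0 = 0.
  by rewrite der_mx_act du hu eq_sym (negPf zu) /=; ring.
have bru : weight_br w x y u 0 = 0 by rewrite mxE wu eq_sym (negPf zu) /=; ring.
apply/matrixP=> i j; rewrite {j}ord1 der_mx_act mxE.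
rewrite [RHS]mxE [weight_br w _ y i 0]mxE [weight_br w x _ i 0]mxE !act0 bru !der_mx_act.
case: (eqVneq i z) => [->|_] /=; last by ring.
rewrite wz !mulr1n !mul1r !mulr0 !subr0.
suff E : pairing h (weight_br w x y) + d z 0 * pairing x y
   = y u 0 * pairing h x - x u 0 * pairing h y
     + pairing (der_mx w d h *m x) y + pairing x (der_mx w d h *m y).
  by apply: (eq_of_subr_eq E); ring.
(* Antisymmetry puts both images under [der_mx] in the first argument, so that the sums agree term
   by term. *)
have -> : pairing x (der_mx w d h *m y) = - pairing (der_mx w d h *m y) x
  by rewrite -pairing_anti.
have -> : d z 0 * pairing x y = \sum_l s l * (d l 0 + d (sg l) 0) * x l 0 * y (sg l) 0.
  rewrite mulr_sumr; apply: eq_bigr => l _.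
  case: (eqVneq (s l) 0) => [->|sl]; first by ring.
  by rewrite dp //; ring.
(* The half carrying [d (sg l) 0] is reindexed by [sg], which flips the sign of [s]. *)
have -> : \sum_l s l * (d l 0 + d (sg l) 0) * x l 0 * y (sg l) 0 =
  \sum_l s l * d l 0 * (x l 0 * y (sg l) 0 - y l 0 * x (sg l) 0).
  under eq_bigr => l _ do rewrite mulrDr !mulrDl.
  under [RHS]eq_bigr => l _ do rewrite mulrBr.
  rewrite big_split sumrB /=; congr (_ + _); first by apply: eq_bigr => l _; ring.
  rewrite (reindex_inj (inv_inj sgK)) /= -sumrN; apply: eq_bigr => l _.
  by rewrite sgK s_sg; ring.
rewrite !mulr_sumr -sumrN -!big_split /= -sumrN -!big_split /=; apply: eq_bigr => l _.
case: (eqVneq (s l) 0) => [->|sl]; first by ring.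
have [lz _] := sign_support sl; have [slz _] := sign_support (s_sg_neq0 sl).
rewrite !der_mx_act mxE (negPf lz) (negPf slz) /=.
have -> : w (sg l) 0 = -1 - w l 0 by rewrite -wz -(wp l sl); ring.
by ring.
Qed.

(** * Determination of all derivations *)

Lemma mul_unitv D b : D *m unitv b = col b D.
Proof.
apply/matrixP=> i j; rewrite !mxE (bigD1 b) //= mxE eqxx mulr1 big1 ?addr0 // => l ne.
by rewrite mxE (negPf ne) mulr0.
Qed.

Lemma weight_br_unitv w y : w u 0 = 0 -> weight_br w (unitv u) y = hadamard w y.
Proof.
move=> wu; apply/matrixP=> i j; rewrite ord1 !mxE pairing_unitl s_u eqxx.
case: eqVneq => [->|_] /=; rewrite ?wu; ring.
Qed.

(** This is the Leibniz rule on [[X_2, X_b] = w_b X_b], read in row [i]. For [b = u] it leaves the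
    off-diagonal entries of the column free; these become [h]. *)
Lemma Der_entries w D i b : regular w -> Der (weight_br w) D ->
  (w b 0 - w i 0) * D i b = w i 0 * D u u * (i == b)%:R
    - w i 0 * D i u * (u == b)%:R + (i == z)%:R * (s (sg b) * D (sg b) u).
Proof.
move=> [[wu _] _ _] /(_ (unitv u) (unitv b)) /matrixP/(_ i 0).
have -> : weight_br w (unitv u) (unitv b) = w b 0 *: unitv b.
  rewrite weight_br_unitv //; apply/matrixP=> k j; rewrite !mxE.
  by case: eqVneq => [->|_] /=; ring.
rewrite weight_br_unitv // -scalemxAr !mul_unitv !mxE pairing_unitr !mxE => E.
by rewrite mulrBl E; ring.
Qed.

(** Simple spectrum kills the off-diagonal entries outside column [u] and row [z], and row [z] is
    tied to column [u] exactly as in [ad h]. *)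
Lemma Der_der_mx w D : regular w -> Der (weight_br w) D ->
  torus (torus_part D) /\ D = der_mx w (torus_part D) (nil_part w D).
Proof.
move=> rw derD; have E i b := Der_entries i b rw derD.
have [[wu wp] wz inj] := rw.
(* The diagonal entry at [z], where [w z 0 = -1], isolates [D u u]. *)
have Duu : D u u = 0.
  have := E z z; rewrite subrr mul0r eqxx eq_sym (negPf zu) s_sgz wz.
  by move/eqP; rewrite !mulr1 mulr0 subr0 mul0r mulr0 addr0 mulN1r eq_sym oppr_eq0 => /eqP.
have off i b : i != b -> b != u -> i != z -> D i b = 0.
  move=> ib bu iz; have /eqP := E i b.
  rewrite (negPf ib) (negPf iz) (eq_sym u) (negPf bu) /= !mulr0 mul0r subr0 addr0.
  rewrite mulf_eq0.
  case/orP => [|/eqP//]; rewrite subr_eq0 => /eqP/inj e.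
  by rewrite e eqxx in ib.
split.
  split=> [|j sj]; first by rewrite mxE.
  have [jz ju] := sign_support sj; have [sjz sju] := sign_support (s_sg_neq0 sj).
  (* The Leibniz rule on a pair of partners yields the torus condition. *)
  have := derD (unitv j) (unitv (sg j)) => /matrixP/(_ z 0).
  rewrite !mul_unitv.
  have -> : weight_br w (unitv j) (unitv (sg j)) = s j *: unitv z.
    apply/matrixP=> k l; rewrite !mxE pairing_unitl !mxE eqxx.
    by rewrite !(eq_sym u) (negPf ju) (negPf sju) /=; ring.
  rewrite -scalemxAr mul_unitv !mxE pairing_unitl pairing_unitr !mxE sgK.
  rewrite !(eq_sym u) (negPf ju) (negPf sju) (off u j) ?(off u (sg j)) //;
    try by rewrite eq_sym.
  rewrite eqxx !(eq_sym z) (negPf jz) (negPf sjz) => e.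
  by apply: (mulfI sj); rewrite e /=; ring.
apply/matrixP=> i b; rewrite !mxE.
case: (eqVneq b u) => [->|bu] /=.
  case: (eqVneq i u) => [->|iu] /=.
    by rewrite eq_sym (negPf zu) Duu wu /=; ring.
  by rewrite s_sgu !(mul0r, mulr0); have w0 := regular_neq0 rw iu; field.
case: (eqVneq i b) => [->|ib] /=.
  case: (eqVneq b z) => [->|_] /=; last by ring.
  by rewrite s_sgz; ring.
case: (eqVneq i z) ib => [->|iz] ib /=; last by rewrite off //; ring.
have sb : s b != 0 by apply: sign_neq0 => //; rewrite eq_sym.
have [_ sbu] := sign_support (s_sg_neq0 sb).
have w0 := regular_neq0 rw sbu.
(* Here [w b 0 - w z 0 = - w (sg b) 0], which is nonzero, so the entry in row [z] is determined by
   column [u]. *)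
have := E z b; rewrite (negPf ib) eqxx (eq_sym u) (negPf bu) /= -(wp b sb) => e.
have -> : s (sg b) * (- D (sg b) u / w (sg b) 0) = - (s (sg b) * D (sg b) u) / w (sg b) 0.
  by field.
have -> : s (sg b) * D (sg b) u = - w (sg b) 0 * D z b.
  by apply: (eq_of_subr_eq (esym e)); ring.
by rewrite !mul0r; field.
Qed.

(** * The Lie bracket of the derivation algebra *)

Lemma regular_torus w : regular w -> torus w.
Proof. by case. Qed.

(** The [H]-component of the bracket in the semidirect product of the torus and [H]. The weights [w]
    do not occur in it, which is what [Der_isomorphic] rests on. *)
Definition nil_br d h d' h' : 'cV[F]_n :=
  hadamard d h' - hadamard d' h + pairing h h' *: unitv z.

Lemma eq_mx_act (A B : 'M[F]_n) :
  (forall (x : 'cV[F]_n) i, (A *m x) i 0 = (B *m x) i 0) -> A = B.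
Proof.
move=> AB; apply/matrixP=> i j; have := AB (unitv j) i.
by rewrite !mul_unitv !mxE.
Qed.

Lemma lieb_der_mx w d h d' h' : regular w -> torus d -> torus d' ->
  h u 0 = 0 -> h' u 0 = 0 ->
  lieb (der_mx w d h) (der_mx w d' h') = der_mx w 0 (nil_br d h d' h').
Proof.
move=> [[wu wp] wz _] [du dp] [du' dp'] hu hu'.
apply: eq_mx_act => x i.
rewrite /lieb mulmxBl -!mulmxA mxE [X in _ + X]mxE !der_mx_act !mxE.
rewrite wu du du' hu hu' [u == z]eq_sym (negPf zu) /=.
case: (eqVneq i z) => [->|_] /=; last by ring.
rewrite wz.
suff E : pairing h (der_mx w d' h' *m x) - pairing h' (der_mx w d h *m x) + d z 0 * pairing h' x
    - d' z 0 * pairing h x =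
    x u 0 * pairing h h' + pairing (nil_br d h d' h') x.
  by apply: (eq_of_subr_eq E); ring.
have act0 (k : 'cV[F]_n) l e : s l != 0 ->
    (der_mx w e k *m x) (sg l) 0 = e (sg l) 0 * x (sg l) 0 - w (sg l) 0 * k (sg l) 0 * x u 0.
  by move=> /s_sg_neq0/sign_support[slz _]; rewrite der_mx_act (negPf slz) /=; ring.
have -> : pairing h (der_mx w d' h' *m x) = \sum_l s l * h l 0 * (d' (sg l) 0 * x (sg l) 0
    - w (sg l) 0 * h' (sg l) 0 * x u 0).
  apply: eq_bigr => l _.
  by case: (eqVneq (s l) 0) => [->|sl]; [ring|rewrite act0].
have -> : pairing h' (der_mx w d h *m x) = \sum_l s l * (h' l 0 * d (sg l) 0 * x (sg l) 0
    + w l 0 * h l 0 * h' (sg l) 0 * x u 0).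
  (* Only the half with [x u 0] is reindexed by [sg], to match the terms in
     [h l 0 * h' (sg l) 0]. *)
  under [RHS]eq_bigr => l _ do rewrite mulrDr.
  rewrite big_split /= [X in _ + X](reindex_inj (inv_inj sgK)) /= -big_split.
  apply: eq_bigr => l _ /=; rewrite sgK s_sg.
  by case: (eqVneq (s l) 0) => [->|sl]; [ring|rewrite act0 //; ring].
rewrite !mulr_sumr -!sumrN -!big_split /=; apply: eq_bigr => l _.
case: (eqVneq (s l) 0) => [->|sl]; first by ring.
have [lz _] := sign_support sl.
rewrite !mxE (negPf lz) /= -(dp l sl) -(dp' l sl).
have -> : w (sg l) 0 = -1 - w l 0 by rewrite -wz -(wp l sl); ring.
by ring.
Qed.

Lemma nil_br_u d h d' h' : torus d -> torus d' -> h u 0 = 0 -> h' u 0 = 0 ->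
  nil_br d h d' h' u 0 = 0.
Proof.
move=> [du _] [du' _] hu hu'; rewrite !mxE du du' eq_sym (negPf zu) /=; ring.
Qed.

Lemma DerP w D : regular w ->
  Der (weight_br w) D <-> exists d h, [/\ torus d, h u 0 = 0 & D = der_mx w d h].
Proof.
move=> rw; split=> [derD|[d [h [td hu ->]]]]; last exact: der_mx_Der.
have [td eD] := Der_der_mx rw derD.
by exists (torus_part D), (nil_part w D); split=> //; apply: nil_part_u.
Qed.

Lemma pairing0l x : pairing 0 x = 0.
Proof. by rewrite /pairing big1 // => l _; rewrite mxE; ring. Qed.

Lemma pairing0r x : pairing x 0 = 0.
Proof. by rewrite pairing_anti pairing0l oppr0. Qed.

Lemma hadamard0l h : hadamard 0 h = 0.
Proof. by apply/matrixP=> i j; rewrite !mxE; ring. Qed.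

Lemma hadamard0r h : hadamard h 0 = 0.
Proof. by apply/matrixP=> i j; rewrite !mxE; ring. Qed.

Lemma hadamard_unit d i : hadamard d (unitv i) = d i 0 *: unitv i.
Proof. by apply/matrixP=> k j; rewrite !mxE; case: eqVneq => [->|_] /=; ring. Qed.

Lemma hadamard_eq0 w h : regular w -> h u 0 = 0 -> hadamard w h = 0 -> h = 0.
Proof.
move=> rw hu /matrixP wh; apply/matrixP=> i j; rewrite {j}ord1 mxE.
case: (eqVneq i u) => [->//|iu]; have := wh i 0; rewrite !mxE => /eqP.
by rewrite mulf_eq0 (negPf (regular_neq0 rw iu)) => /eqP.
Qed.

Lemma unitv_u i : i != u -> unitv i u 0 = 0.
Proof. by move=> iu; rewrite mxE eq_sym (negPf iu). Qed.

Lemma lieb_torusl w d d' h' : regular w -> torus d -> torus d' -> h' u 0 = 0 ->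
  lieb (der_mx w d 0) (der_mx w d' h') = der_mx w 0 (hadamard d h').
Proof.
move=> rw td td' hu; rewrite lieb_der_mx //; last by rewrite mxE.
by rewrite /nil_br hadamard0r pairing0l scale0r subr0 addr0.
Qed.

Lemma lieb_nil w h h' : regular w -> h u 0 = 0 -> h' u 0 = 0 ->
  lieb (der_mx w 0 h) (der_mx w 0 h') = der_mx w 0 (pairing h h' *: unitv z).
Proof.
move=> rw hu hu'; rewrite lieb_der_mx //; try exact: torus0.
by rewrite /nil_br !hadamard0l subr0 add0r.
Qed.

(** * The derived series *)

Lemma derived_ind (L P : 'M[F]_n -> Prop) m :
  P 0 -> (forall A B, P A -> P B -> P (A + B)) ->
  (forall A B, derived L m A -> derived L m B -> P (lieb A B)) ->
  forall A, derived L m.+1 A -> P A.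
Proof.
move=> P0 PD Pl _ [S [inS ->]]; rewrite big_seq; elim/big_ind: _ => // ab /inS[].
exact: Pl.
Qed.

Lemma derived_lieb (L : 'M[F]_n -> Prop) m A B :
  derived L m A -> derived L m B -> derived L m.+1 (lieb A B).
Proof.
move=> LA LB; exists [:: (A, B)]; split; last by rewrite big_seq1.
by move=> ab; rewrite inE => /eqP->.
Qed.

Lemma derived1 w D : regular w -> derived (Der (weight_br w)) 1 D ->
  exists2 h : 'cV[F]_n, h u 0 = 0 & D = der_mx w 0 h.
Proof.
move=> rw.
apply: (derived_ind (P := fun D => exists2 h : 'cV[F]_n, h u 0 = 0 & D = der_mx w 0 h)) =>
  [|_ _ [h hu ->] [h' hu' ->]|].
- by exists 0; rewrite ?mxE ?der_mx00.
- by exists (h + h'); rewrite ?der_mxD ?addr0 // mxE hu hu' addr0.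
move=> _ _ /(DerP _ rw)[d [h [td hu ->]]] /(DerP _ rw)[d' [h' [td' hu' ->]]].
by exists (nil_br d h d' h'); [apply: nil_br_u|apply: lieb_der_mx].
Qed.

Lemma derived2 w D : regular w -> derived (Der (weight_br w)) 2 D ->
  exists c, D = der_mx w 0 (c *: unitv z).
Proof.
move=> rw.
apply: (derived_ind (P := fun D => exists c, D = der_mx w 0 (c *: unitv z))) =>
  [|_ _ [c ->] [c' ->]|].
- by exists 0; rewrite scale0r der_mx00.
- by exists (c + c'); rewrite scalerDl der_mxD addr0.
move=> _ _ /(derived1 rw)[h hu ->] /(derived1 rw)[h' hu' ->].
by exists (pairing h h'); apply: lieb_nil.
Qed.

Lemma derived3 w D : regular w -> derived (Der (weight_br w)) 3 D -> D = 0.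
Proof.
move=> rw; apply: (derived_ind (P := eq^~ 0)) => // [_ _ -> ->|]; first exact: addr0.
have cu c : (c *: unitv z) u 0 = 0 by rewrite mxE unitv_u ?mulr0.
move=> _ _ /(derived2 rw)[c ->] /(derived2 rw)[c' ->].
(* Multiples of the central vector pair to zero because [s z = 0]. *)
rewrite lieb_nil // (_ : pairing _ _ = 0) ?scale0r ?der_mx00 // /pairing big1 // => l _.
rewrite !mxE; case: (eqVneq l z) => [->|_] /=; last by ring.
by rewrite s_z; ring.
Qed.

(** The inner derivation of a basis vector of nonzero weight is a multiple of its own bracket with
    [ad X_2]. *)
Lemma unitv_derived1 w i : regular w -> i != u ->
  derived (Der (weight_br w)) 1 (der_mx w 0 (unitv i)).
Proof.
move=> rw iu; have w0 := regular_neq0 rw iu; have tw := regular_torus rw.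
have hu : ((w i 0)^-1 *: unitv i) u 0 = 0 by rewrite mxE unitv_u ?mulr0.
have -> : der_mx w 0 (unitv i) = lieb (der_mx w w 0) (der_mx w 0 ((w i 0)^-1 *: unitv i)).
  rewrite lieb_torusl //; last exact: torus0.
  congr (der_mx _ _ _); apply/matrixP=> k l; rewrite !mxE.
  by case: (eqVneq k i) => [->|_] /=; [field|ring].
by apply: derived_lieb; apply: der_mx_Der => //; [rewrite mxE|apply: torus0].
Qed.

Lemma der_mx_inj w d h d' h' : regular w -> d u 0 = 0 -> d' u 0 = 0 ->
  h u 0 = 0 -> h' u 0 = 0 -> der_mx w d h = der_mx w d' h' -> d = d' /\ h = h'.
Proof.
move=> rw du du' hu hu' e; split.
  by rewrite -(torus_part_der_mx w d hu) e torus_part_der_mx.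
by rewrite -(nil_part_der_mx rw du hu) e nil_part_der_mx.
Qed.

(** The bracket of the inner derivations of two partners is [s j] times [ad X_1], a nonzero element
    of the second derived algebra. *)
Lemma derived_length3 w j : regular w -> s j != 0 ->
  derived_length (Der (weight_br w)) 3.
Proof.
move=> rw sj; split=> [D|]; first exact: derived3.
have [_ ju] := sign_support sj; have [_ sju] := sign_support (s_sg_neq0 sj).
exists (lieb (der_mx w 0 (unitv j)) (der_mx w 0 (unitv (sg j)))); split.
  by apply: derived_lieb; apply: unitv_derived1.
rewrite lieb_nil ?unitv_u // -(der_mx00 w) => /der_mx_inj[]//; rewrite ?mxE //.
  by rewrite eq_sym (negPf zu) mulr0.
move=> _ /matrixP/(_ z 0); rewrite pairing_unitl !mxE !eqxx !mulr1.
by move/eqP: sj.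
Qed.

(** Both maps keep the components [(d, h)] and exchange [w] for [w']; they respect brackets since
    [nil_br] is independent of the weights. *)
Lemma Der_isomorphic w w' : regular w -> regular w' ->
  lie_isomorphic (Der (weight_br w)) (Der (weight_br w')).
Proof.
move=> rw rw'.
exists (fun D => der_mx w' (torus_part D) (nil_part w D)),
  (fun D => der_mx w (torus_part D) (nil_part w' D)).
split; first split.
- by move=> D /(Der_der_mx rw)[td _]; apply: der_mx_Der => //; apply: nil_part_u.
- by move=> D /(Der_der_mx rw')[td _]; apply: der_mx_Der => //; apply: nil_part_u.
- move=> _ /(DerP _ rw)[d [h [[du _] hu ->]]].
  by rewrite !(torus_part_der_mx, nil_part_der_mx).
- move=> _ /(DerP _ rw')[d [h [[du _] hu ->]]].
  by rewrite !(torus_part_der_mx, nil_part_der_mx).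
- move=> a D E _ _; rewrite -der_mx_linear; congr (der_mx _ _ _);
    by apply/matrixP=> i j; rewrite !mxE; ring.
move=> _ _ /(DerP _ rw)[d [h [td hu ->]]] /(DerP _ rw)[d' [h' [td' hu' ->]]].
have [[du _] [du' _]] := (td, td'); have bu := nil_br_u td td' hu hu'.
rewrite lieb_der_mx // !torus_part_der_mx // !nil_part_der_mx ?lieb_der_mx //.
by rewrite mxE.
Qed.

(** * Derivations of the derivation algebra, and completeness *)

Lemma Der_linear w a A B : regular w -> Der (weight_br w) A -> Der (weight_br w) B ->
  Der (weight_br w) (a *: A + B).
Proof.
move=> rw /(DerP _ rw)[d [h [td hu ->]]] /(DerP _ rw)[d' [h' [td' hu' ->]]].
rewrite -der_mx_linear; apply: der_mx_Der => //; first exact: torus_linear.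
by rewrite !mxE hu hu'; ring.
Qed.

Lemma Der_lieb w A B : regular w -> Der (weight_br w) A -> Der (weight_br w) B ->
  Der (weight_br w) (lieb A B).
Proof.
move=> rw /(DerP _ rw)[d [h [td hu ->]]] /(DerP _ rw)[d' [h' [td' hu' ->]]].
by rewrite lieb_der_mx //; apply: der_mx_Der; rewrite ?nil_br_u //; apply: torus0.
Qed.

Lemma lieb_linearr a (Z A B : 'M[F]_n) :
  lieb Z (a *: A + B) = a *: lieb Z A + lieb Z B.
Proof.
rewrite /lieb mulmxDl mulmxDr -scalemxAl -scalemxAr scalerBr opprD.
by rewrite !addrA; congr (_ + _); rewrite -!addrA; congr (_ + _); apply: addrC.
Qed.

Lemma lieb_addl (A B Z : 'M[F]_n) : lieb (A + B) Z = lieb A Z + lieb B Z.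
Proof.
rewrite /lieb mulmxDl mulmxDr opprD.
by rewrite !addrA; congr (_ + _); rewrite -!addrA; congr (_ + _); apply: addrC.
Qed.

Lemma lieb_jacobi (Z A B : 'M[F]_n) :
  lieb Z (lieb A B) = lieb (lieb Z A) B + lieb A (lieb Z B).
Proof.
rewrite /lieb !mulmxBl !mulmxBr !mulmxA.
move: (Z *m A *m B) (Z *m B *m A) (A *m B *m Z) (B *m A *m Z) (A *m Z *m B)
  (B *m Z *m A) => c1 c2 c3 c4 c5 c6.
by apply/matrixP=> i j; rewrite !mxE; ring.
Qed.

Lemma lieb0l (A : 'M[F]_n) : lieb 0 A = 0.
Proof. by rewrite /lieb mul0mx mulmx0 subrr. Qed.

Lemma lieb0r (A : 'M[F]_n) : lieb A 0 = 0.
Proof. by rewrite /lieb mul0mx mulmx0 subrr. Qed.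

Lemma lieb_Zl a (A B : 'M[F]_n) : lieb (a *: A) B = a *: lieb A B.
Proof. by rewrite /lieb -scalemxAl -scalemxAr scalerBr. Qed.

Lemma lieb_Zr a (A B : 'M[F]_n) : lieb A (a *: B) = a *: lieb A B.
Proof. by rewrite /lieb -scalemxAl -scalemxAr scalerBr. Qed.

Lemma lieb_subl (A B Z : 'M[F]_n) : lieb (A - B) Z = lieb A Z - lieb B Z.
Proof. by rewrite lieb_addl -scaleN1r lieb_Zl scaleN1r. Qed.

Lemma lieb_subr (A B Z : 'M[F]_n) : lieb Z (A - B) = lieb Z A - lieb Z B.
Proof. by rewrite addrC -scaleN1r lieb_linearr scaleN1r addrC. Qed.

Lemma lie_derivation_subad w f Z : regular w -> lie_derivation (Der (weight_br w)) f ->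
  Der (weight_br w) Z -> lie_derivation (Der (weight_br w)) (fun A => f A - lieb Z A).
Proof.
move=> rw [fL flin fbr] LZ; split=> [A LA|a A B LA LB|A B LA LB].
- by rewrite addrC -scaleN1r; apply: Der_linear; [| exact: Der_lieb | exact: fL].
- rewrite flin // lieb_linearr [X in _ = X + _]scalerBr.
  by rewrite opprD addrACA.
- by rewrite fbr // lieb_jacobi lieb_subl lieb_subr opprD addrACA.
Qed.

Lemma Der0 w : regular w -> Der (weight_br w) 0.
Proof.
by move=> rw; rewrite -(der_mx00 w); apply: der_mx_Der; rewrite ?mxE //; apply: torus0.
Qed.

Lemma Der_weights w : regular w -> Der (weight_br w) (der_mx w w 0).
Proof. by move=> rw; apply: der_mx_Der; rewrite ?mxE //; apply: regular_torus. Qed.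

Lemma Der_unitv w i : regular w -> i != u -> Der (weight_br w) (der_mx w 0 (unitv i)).
Proof. by move=> rw iu; apply: der_mx_Der; rewrite ?unitv_u //; apply: torus0. Qed.

Section Derivation.
Variables (w : 'cV[F]_n) (f : 'M[F]_n -> 'M[F]_n).
Hypothesis rw : regular w.
Hypothesis fder : lie_derivation (Der (weight_br w)) f.

(** [T] is [ad X_2], and [E i] is the inner derivation of the basis vector of index [i]. *)
Let L := Der (weight_br w).
Let E i : 'M[F]_n := der_mx w 0 (unitv i).
Let T : 'M[F]_n := der_mx w w 0.

Let LE i : i != u -> L (E i). Proof. exact: Der_unitv. Qed.
Let LT : L T. Proof. exact: Der_weights. Qed.
Let L0 : L 0. Proof. exact: Der0. Qed.

Lemma derivation0 : f 0 = 0.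
Proof.
case: fder => _ lin _.
by have := lin (-1) 0 0 L0 L0; rewrite scaler0 addr0 scaleN1r addNr.
Qed.

Lemma derivationZ a A : L A -> f (a *: A) = a *: f A.
Proof.
case: fder => _ lin _ LA.
by have := lin a A 0 LA L0; rewrite derivation0 !addr0.
Qed.

(** Write [f (E i)] as [diag c + ad k] and apply [f] to [[T, E i] = w_i E i]. The torus part gives
    [w_i c = 0], entry [i] gives [a_i = 0], and entry [j] gives [(w_j - w_i) k_j = 0]. *)
Lemma derivation_unitv a i : torus a -> f T = der_mx w a 0 -> i != u ->
  a i 0 = 0 /\ f (E i) = nil_part w (f (E i)) i 0 *: E i.
Proof.
move=> ta fT iu; case: fder => fL _ fbr.
have [c [k [tc ku fE]]] : exists c k, [/\ torus c, k u 0 = 0 & f (E i) = der_mx w c k].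
  by apply/DerP => //; apply/fL/LE.
have ui : unitv i u 0 = 0 by apply: unitv_u.
have := fbr T (E i) LT (LE iu).
rewrite fT fE !lieb_torusl //; try exact: torus0; try exact: regular_torus.
(* The zero torus component is written as a multiple of [w i 0], so that the argument of [f] folds
   to [w i 0 *: E i]. *)
rewrite !hadamard_unit der_mxD addr0 -[X in der_mx w X (_ *: _)](scaler0 _ (w i 0)) -der_mxZ.
rewrite -/(E i) derivationZ; last exact: LE.
rewrite fE der_mxZ.
case/der_mx_inj=> //; try by rewrite !mxE ?(proj1 tc) ?(eq_sym u) ?(negPf iu) ?ku ?mulr0 ?addr0.
move=> c0 k0; have w0 := regular_neq0 rw iu.
have {}c0 : c = 0.
  by move/eqP: c0; rewrite scaler_eq0 (negPf w0) => /eqP.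
have ai : a i 0 = 0.
  have /matrixP/(_ i 0) := k0; rewrite !mxE eqxx mulr1 => /eqP.
  by rewrite -subr_eq0 opprD addrCA subrr addr0 oppr_eq0 => /eqP.
split=> //; rewrite nil_part_der_mx ?(proj1 tc) // c0 der_mxZ scaler0; congr (der_mx _ _ _).
apply/matrixP=> j l; rewrite {l}ord1 !mxE; case: (eqVneq j i) => [->|ji] /=.
  by rewrite mulr1.
have /matrixP/(_ j 0) := k0; rewrite !mxE (negPf ji) mulr0 add0r => /eqP.
rewrite -subr_eq0 -mulrBl mulf_eq0 mulr0 => /orP[|/eqP//].
by rewrite subr_eq0; case: rw => _ _ inj /eqP/inj/esym/eqP; rewrite (negPf ji).
Qed.

(** The eigenvalues form a torus element because [f] respects [[E j, E (sg j)] = s_j E z]. *)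
Lemma derivation_eigenvalues a : torus a -> f T = der_mx w a 0 ->
  f T = 0 /\ exists2 v : 'cV[F]_n, torus v & forall i, i != u -> f (E i) = v i 0 *: E i.
Proof.
move=> ta fT; have H i := derivation_unitv (i := i) ta fT; split.
  rewrite fT (_ : a = 0) ?der_mx00 //; apply/matrixP=> i j; rewrite {j}ord1 mxE.
  by case: (eqVneq i u) => [->|/H[]//]; case: ta.
(* The value [0] at [u] is the one that [torus] prescribes. *)
pose v : 'cV[F]_n := \col_i (if i == u then 0 else nil_part w (f (E i)) i 0).
have fE i : i != u -> f (E i) = v i 0 *: E i.
  by move=> iu; rewrite [v i 0]mxE (negPf iu); case: (H i iu).
have vu : v u 0 = 0 by rewrite mxE eqxx.
clearbody v; exists v => //; split=> // j sj.
have [_ ju] := sign_support sj; have [_ sju] := sign_support (s_sg_neq0 sj).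
have eEE : lieb (E j) (E (sg j)) = s j *: E z.
  by rewrite lieb_nil ?unitv_u // pairing_unitl mxE eqxx mulr1 der_mxZ scaler0.
case: fder => _ _ /(_ (E j) (E (sg j)) (LE ju) (LE sju)).
rewrite eEE derivationZ; last exact: LE.
rewrite !fE // lieb_Zl lieb_Zr eEE.
rewrite !scalerA -scalerDl !der_mxZ !scaler0.
case/der_mx_inj => //; try by rewrite !mxE ?(eq_sym u) ?(negPf zu) ?mulr0.
move=> _ /matrixP/(_ z 0); rewrite !mxE eqxx !mulr1 -mulrDl mulrC => /(mulIf sj).
by move->.
Qed.

Lemma der_mx_sum h : h u 0 = 0 -> der_mx w 0 h = \sum_(i | i != u) h i 0 *: E i.
Proof.
move=> hu; rewrite (_ : der_mx w 0 h = der_mx w 0 (\sum_(i | i != u) h i 0 *: unitv i)).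
  rewrite -[LHS](_ : \sum_(i | i != u) der_mx w 0 (h i 0 *: unitv i) = _).
    by apply: eq_bigr => i _; rewrite der_mxZ scaler0.
  elim/big_rec2: _ => [|i A x _ ->]; first by rewrite der_mx00.
  by rewrite der_mxD addr0.
congr (der_mx _ _ _); apply/matrixP=> k j; rewrite {j}ord1 summxE.
case: (eqVneq k u) => [->|ku].
  by rewrite hu big1 // => i iu; rewrite !mxE eq_sym (negPf iu) mulr0.
rewrite (bigD1 k) //= !mxE eqxx mulr1 big1 ?addr0 // => i /andP[_ ik].
by rewrite !mxE eq_sym (negPf ik) mulr0.
Qed.

(** Linearity disposes of [ad H]. The image of a torus element then commutes with [T], which removes
    its [H]-component, and with every [E i], which removes its torus component. *)
Lemma derivation_eq0 : f T = 0 -> (forall i, i != u -> f (E i) = 0) ->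
  forall A, L A -> f A = 0.
Proof.
move=> fT fE; case: (fder) => fL lin fbr.
have fnil (h : 'cV[F]_n) : h u 0 = 0 -> f (der_mx w 0 h) = 0.
  (* Membership in [L] is carried through the induction, since [f] is linear only on [L]. *)
  move=> /der_mx_sum->; apply: (proj2 (A := L (\sum_(i | i != u) h i 0 *: E i))).
  elim/big_ind: _ => [|A B [LA fA] [LB fB]|i iu].
  - by split=> //; apply: derivation0.
  - split; first by rewrite -[A]scale1r; apply: Der_linear.
    by rewrite -[A]scale1r lin // fA fB scaler0 addr0.
  - split; last by rewrite derivationZ ?fE ?scaler0 //; apply: LE.
    rewrite der_mxZ scaler0; apply: der_mx_Der => //; first exact: torus0.
    by rewrite mxE unitv_u ?mulr0.
have ftorus d : torus d -> f (der_mx w d 0) = 0.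
  move=> td; have Ld : L (der_mx w d 0) by apply: der_mx_Der; rewrite ?mxE.
  have [c [k [tc ku fd]]] :
    exists c k, [/\ torus c, k u 0 = 0 & f (der_mx w d 0) = der_mx w c k].
    by apply/DerP => //; apply: fL.
  have tw := regular_torus rw.
  have k0 : k = 0.
    have := fbr T _ LT Ld; rewrite fT lieb0l add0r fd !lieb_torusl ?mxE //.
    rewrite hadamard0r fnil ?mxE // -(der_mx00 w) => /esym/der_mx_inj[];
      rewrite ?mxE ?ku ?mulr0 //.
    by move=> _ /(hadamard_eq0 rw ku).
  rewrite fd k0 (_ : c = 0) ?der_mx00 //; apply/matrixP=> i j; rewrite {j}ord1 mxE.
  case: (eqVneq i u) => [->|iu]; first by case: tc.
  have ui := unitv_u iu.
  have := fbr _ _ Ld (LE iu); rewrite fE // lieb0r addr0 fd k0 !lieb_torusl //; try exact: torus0.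
  rewrite !hadamard_unit fnil; last by rewrite mxE ui mulr0.
  rewrite -(der_mx00 w) => /esym/der_mx_inj[]; rewrite ?mxE ?(eq_sym u) ?(negPf iu) ?mulr0 //.
  by move=> _ /matrixP/(_ i 0); rewrite !mxE eqxx mulr1.
move=> A /(DerP _ rw)[d [h [td hu ->]]].
have -> : der_mx w d h = 1 *: der_mx w d 0 + der_mx w 0 h
  by rewrite scale1r der_mxD addr0 add0r.
rewrite lin; first by rewrite ftorus // fnil // scaler0 addr0.
  by apply: der_mx_Der; rewrite ?mxE.
by apply: der_mx_Der => //; apply: torus0.
Qed.

End Derivation.

Lemma lieb_torusr w d h : regular w -> torus d -> h u 0 = 0 ->
  lieb (der_mx w d h) (der_mx w w 0) = der_mx w 0 (- hadamard w h).
Proof.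
move=> rw td hu; rewrite lieb_der_mx ?mxE //; last exact: regular_torus.
by rewrite /nil_br hadamard0r pairing0r scale0r addr0 sub0r.
Qed.

(** A central element has no [H]-component because it commutes with [ad X_2], and no torus component
    because it commutes with the remaining inner derivations. *)
Lemma Der_complete w : regular w -> lie_complete (Der (weight_br w)).
Proof.
move=> rw; have tw := regular_torus rw.
have LT := Der_weights rw.
split.
  move=> _ /(DerP _ rw)[d [h [td hu ->]]] cen.
  have h0 : h = 0.
    apply: (hadamard_eq0 rw hu); apply/eqP; rewrite -oppr_eq0; apply/eqP.
    have := cen _ LT; rewrite lieb_torusr // -(der_mx00 w) => /der_mx_inj[]; rewrite ?mxE //.
    by rewrite hu mulr0 oppr0.
  rewrite h0 (_ : d = 0) ?der_mx00 //; apply/matrixP=> i j; rewrite {j}ord1 mxE.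
  case: (eqVneq i u) => [->|iu]; first by case: td.
  have := cen _ (Der_unitv rw iu); rewrite h0 lieb_torusl ?unitv_u //; last exact: torus0.
  rewrite hadamard_unit -(der_mx00 w) => /der_mx_inj[];
    rewrite ?mxE ?(eq_sym u) ?(negPf iu) ?mulr0 //.
  by move=> _ /matrixP/(_ i 0); rewrite !mxE eqxx mulr1.
move=> f fder.
have [a [b [ta bu fT]]] :
  exists (a b : 'cV[F]_n), [/\ torus a, b u 0 = 0 & f (der_mx w w 0) = der_mx w a b].
  by apply/(DerP _ rw); case: fder => fL _ _; apply: fL.
(* Chosen so that [[ad k, ad X_2] = ad b]; subtracting [ad k] moves the image of [ad X_2] into the
   torus. *)
pose k : 'cV[F]_n := \col_i (- b i 0 / w i 0).
have ku : k u 0 = 0 by rewrite mxE bu oppr0 mul0r.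
have Lk : Der (weight_br w) (der_mx w 0 k) by apply: der_mx_Der => //; apply: torus0.
have gder := lie_derivation_subad rw fder Lk.
have [|gT [v tv gE]] := derivation_eigenvalues rw gder ta.
  rewrite fT lieb_torusr //; last exact: torus0.
  rewrite -scaleN1r der_mxZ der_mxD scaler0 addr0; congr (der_mx _ _ _).
  apply/matrixP=> i j; rewrite {j}ord1 !mxE; case: (eqVneq i u) => [->|iu].
    by rewrite bu; ring.
  by have := regular_neq0 rw iu => w0; field.
have Lv : Der (weight_br w) (der_mx w v 0) by apply: der_mx_Der; rewrite ?mxE.
(* After the further subtraction of [diag v], the derivation kills [ad X_2] and every [E i]. *)
have zero := derivation_eq0 rw (lie_derivation_subad rw gder Lv).
exists (der_mx w 0 k + der_mx w v 0).
  by rewrite -[der_mx w 0 k]scale1r; apply: Der_linear.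
move=> A LA; apply/eqP; rewrite -subr_eq0 lieb_addl opprD addrA; apply/eqP.
apply: zero => //.
  rewrite gT lieb_torusl ?mxE //.
  by rewrite hadamard0r der_mx00 subrr.
move=> i iu; rewrite gE // lieb_torusl ?unitv_u //; last exact: torus0.
by rewrite hadamard_unit der_mxZ scaler0 subrr.
Qed.

End TorusHeisenberg.

(** * The bracket of [F_phi] *)

Section FphiBracket.
Set Implicit Arguments.
Unset Strict Implicit.
Variables (R : realType) (p : nat).
Local Notation C := R[i].

(** Indices start at 0, so [X_{2k+1}] sits at the even index [2k] and its partner just above. *)
Definition swap k := if odd k then k.-1 else k.+1.

Lemma swap_lt (i : 'I_(2 * p)) : (swap i < 2 * p)%N.
Proof. by rewrite /swap; have := ltn_ord i; case: ifP; lia. Qed.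

Definition partner (i : 'I_(2 * p)) : 'I_(2 * p) := Ordinal (swap_lt i).

Lemma swapK : involutive swap.
Proof. by move=> k; rewrite /swap; case: (boolP (odd k)) => ok; case: ifP; lia. Qed.

Lemma partnerK : involutive partner.
Proof. by move=> i; apply/val_inj/swapK. Qed.

Definition pairing_sign (i : 'I_(2 * p)) : C := if (i < 2)%N then 0 else (-1) ^+ odd i.

Lemma pairing_sign_partner (i : 'I_(2 * p)) :
  pairing_sign (partner i) = - pairing_sign i.
Proof.
rewrite /pairing_sign /= /swap; case: i => -[|[|k]] _ //=; rewrite ?oppr0 //.
rewrite negbK; case: (boolP (odd k)) => ok /=; last by rewrite ok expr1 expr0.
by case: k ok => [|k] //= ok; rewrite negbK (negPf ok) /= expr1 expr0 opprK.
Qed.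

Hypothesis p_ge2 : (2 <= p)%N.

Lemma ord0_lt : (0 < 2 * p)%N. Proof. by lia. Qed.
Lemma ord1_lt : (1 < 2 * p)%N. Proof. by lia. Qed.
Lemma ord2_lt : (2 < 2 * p)%N. Proof. by lia. Qed.

Definition idx1 : 'I_(2 * p) := Ordinal ord0_lt.
Definition idx2 : 'I_(2 * p) := Ordinal ord1_lt.

Lemma pairing_sign_eq0 (i : 'I_(2 * p)) :
  (pairing_sign i == 0) = (i == idx1) || (i == idx2).
Proof.
rewrite /pairing_sign -!val_eqE /=; case: i => -[|[|k]] _ //=; rewrite ?eqxx //.
by rewrite signr_eq0.
Qed.

Variable phi : 'I_p.-1 -> C.

(** The eigenvalues of [ad X_2]: the value [-1] at index 0 comes from [[X_2, X_1] = - X_1]. *)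
Definition weight (k : nat) : C := if k == 0%N then -1 else if k == 1%N then 0 else wt phi k.

Definition weights : 'cV[C]_(2 * p) := \col_i weight i.

Lemma Fbas_entry (a b i : 'I_(2 * p)) : Fbas (2 * p) phi a b i 0 =
  weight i * ((a == idx2)%:R * (b == i)%:R - (a == i)%:R * (b == idx2)%:R)
  + (i == idx1)%:R * (pairing_sign a * (b == partner a)%:R).
Proof.
rewrite -!val_eqE /= /Fbas /weight /pairing_sign /swap.
case: a b => a _ [b _] /=; case: a => [|[|a]]; case: b => [|[|b]] //=;
  rewrite ?mxE /=.
all: try by case: eqVneq => [->|_] /=; ring.
- by ring.
- by rewrite andbF mxE; ring.
- by rewrite andbF mxE; case: (odd a) => /=; ring.
- rewrite (eq_sym a.+2) [1%N == if _ then _ else _](_ : _ = false);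
    last by case: a => //= a; case: ifP.
  by case: eqVneq => [->|_] /=; ring.
(* Both basis indices are now at least 2; the parity of [a] decides which of the last two nonzero
   branches of [Fbas] can occur. *)
case: (boolP (odd a)) => oa /=.
  case: (eqVneq a.+2 b.+3) => [[e]|ne].
    by rewrite e /= in oa *; rewrite (negPf oa) eqxx !mxE /=; ring.
  have -> : (b.+2 == a.+1) = false by apply/eqP => e; case/eqP: ne; rewrite e.
  by rewrite andbF mxE /=; ring.
case: (eqVneq b.+2 a.+3) => [[e]|ne] /=; first by rewrite mxE; ring.
rewrite (_ : _ && _ = false) ?mxE /=; first by ring.
by apply/negbTE/negP => /andP[ob /eqP[e]]; rewrite e /= in oa; rewrite oa in ob.
Qed.

Lemma sum_delta n (j : 'I_n) (G : 'I_n -> C) : \sum_b (b == j)%:R * G b = G j.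
Proof.
rewrite (bigD1 j) //= eqxx mul1r big1 ?addr0 // => b bj.
by rewrite (negPf bj) mul0r.
Qed.

(** The Kronecker deltas of [Fbas_entry] collapse the double sum, first over [b], then over [a]. *)
Lemma Fbr_weight_br : Fbr phi = weight_br idx1 idx2 partner pairing_sign weights.
Proof.
apply/funext => x; apply/funext => y; apply/matrixP=> i j; rewrite {j}ord1 summxE !mxE.
transitivity (\sum_a ((a == idx2)%:R * (weight i * x a 0 * y i 0)
   - (a == i)%:R * (weight i * x a 0 * y idx2 0)
   + (i == idx1)%:R * (pairing_sign a * x a 0 * y (partner a) 0))).
  apply: eq_bigr => a _; rewrite summxE.
  transitivity (\sum_b ((b == i)%:R * ((a == idx2)%:R * weight i * x a 0 * y b 0)
     - (b == idx2)%:R * ((a == i)%:R * weight i * x a 0 * y b 0)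
     + (b == partner a)%:R * ((i == idx1)%:R * pairing_sign a * x a 0 * y b 0))).
    by apply: eq_bigr => b _; rewrite mxE Fbas_entry; ring.
  by rewrite big_split sumrB /= !sum_delta; ring.
by rewrite big_split sumrB /= !sum_delta -mulr_sumr /pairing; ring.
Qed.

(** As [l] starts at 0, [phi l] belongs to [X_{2l+3}] and [X_{2l+4}], whose 0-based indices are
    [2l+2] and [2l+3]. *)
Lemma weight_cases k : (k < 2 * p)%N ->
  [\/ k = 0%N /\ weight k = -1, k = 1%N /\ weight k = 0,
      exists l : 'I_p.-1, k = (2 * l + 2)%N /\ weight k = phi l |
      exists l : 'I_p.-1, k = (2 * l + 3)%N /\ weight k = - (1 + phi l)].
Proof.
case: k => [|[|k]] kp; [by apply: Or41|by apply: Or42|].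
have lp : (k./2 < p.-1)%N by lia.
have phikE : phik phi k./2 = phi (Ordinal lp) by rewrite /phik insubT.
rewrite /weight /wt /= negbK phikE.
case: (boolP (odd k)) => ok; [apply: Or44|apply: Or43]; exists (Ordinal lp);
  split=> //=; lia.
Qed.

Lemma weight_swap k : (1 < k)%N -> weight k + weight (swap k) = -1.
Proof.
case: k => [|[|k]] // _; rewrite /weight /swap /wt /= negbK.
case: (boolP (odd k)) => ok /=; last first.
  by rewrite (negPf ok) negbK /= uphalf_half (negPf ok); ring.
case: k ok => //= k ok; rewrite negbK (negPf ok) /= uphalf_half (negPf ok) /=; ring.
Qed.

(** * Distinctness of the weights off [Omega_1] *)

Hypothesis phi_generic : ~ inOmega1 phi.

(** A coincidence between weights of distinct indices forces [1 = 0] or puts [phi] on a hyperplane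
    of [Omega_1]. The case [l = m] of [c2] separates the two partners [X_{2l+3}] and [X_{2l+4}]. *)
Lemma weight_inj i j : (i < 2 * p)%N -> (j < 2 * p)%N -> weight i = weight j -> i = j.
Proof.
move=> ip jp.
have c0 l : phi l <> 0 by move=> e; apply: phi_generic; do 3 right; left; exists l.
have c1 l : phi l + 1 <> 0 by move=> e; apply: phi_generic; do 4 right; left; exists l.
have c2 l m : 1 + phi l + phi m <> 0.
  by move=> e; apply: phi_generic; left; exists l, m.
have c3 l m : phi l = phi m -> l = m.
  move=> e; apply/eqP/negPn/negP => lm; apply: phi_generic; do 2 right; left.
  by exists l, m; rewrite e subrr.
have eq0 (x y c : C) : x = y -> c = x - y -> c = 0 by move=> -> ->; rewrite subrr.
case: (weight_cases ip) => [[-> ->]|[-> ->]|[l [-> ->]]|[l [-> ->]]];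
case: (weight_cases jp) => [[-> ->]|[-> ->]|[m [-> ->]]|[m [-> ->]]] e //.
- by case/eqP: (oner_neq0 C); apply: (eq0 _ _ _ (esym e)); ring.
- by case: (c1 m); apply: (eq0 _ _ _ (esym e)); ring.
- by case: (c0 m); apply: (eq0 _ _ _ e); ring.
- by case/eqP: (oner_neq0 C); apply: (eq0 _ _ _ e); ring.
- by case: (c0 m).
- by case: (c1 m); apply: (eq0 _ _ _ e); ring.
- by case: (c1 l); apply: (eq0 _ _ _ e); ring.
- by case: (c0 l).
- by rewrite (c3 _ _ e).
- by case: (c2 l m); apply: (eq0 _ _ _ e); ring.
- by case: (c0 l); apply: (eq0 _ _ _ (esym e)); ring.
- by case: (c1 l); apply: (eq0 _ _ _ (esym e)); ring.
- by case: (c2 l m); apply: (eq0 _ _ _ (esym e)); ring.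
- by rewrite (c3 l m) //; apply: (eq_of_subr_eq (esym e)); ring.
Qed.

Lemma weights_regular : regular idx1 idx2 partner pairing_sign weights.
Proof.
split; [split=> [|j]|by rewrite mxE|move=> i j]; first by rewrite mxE.
  rewrite pairing_sign_eq0 -!val_eqE /= => j2; rewrite !mxE weight_swap //=.
  by case: (val j) j2 => [|[]].
by rewrite !mxE => /(weight_inj (ltn_ord i) (ltn_ord j))/val_inj.
Qed.

End FphiBracket.

Theorem theorem2 (R : realType) (p : nat) (hp : (2 <= p)%N) :
  (forall phi : 'I_p.-1 -> R[i], ~ inOmega1 phi ->
     lie_solvable (Der (Fbr phi)) /\ derived_length (Der (Fbr phi)) 3 /\
     lie_complete (Der (Fbr phi))) /\
  (forall phi phi' : 'I_p.-1 -> R[i], ~ inOmega1 phi -> ~ inOmega1 phi' ->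
     lie_isomorphic (Der (Fbr phi)) (Der (Fbr phi'))).
Proof.
have zu : idx1 hp != idx2 hp by [].
have sK := @partnerK p.
have sN := @pairing_sign_partner R p.
have s0 := pairing_sign_eq0 R hp.
have reg phi := @weights_regular R p hp phi.
split=> [phi /reg rw|phi phi' /reg rw /reg rw']; rewrite !(Fbr_weight_br hp); last first.
  exact: Der_isomorphic.
have len : derived_length (Der (Fbr phi)) 3.
  rewrite (Fbr_weight_br hp).
  (* The index 2 is that of [X_3], which exists since [p >= 2] and has sign [1]. *)
  apply: (derived_length3 zu sK sN s0 (j := Ordinal (ord2_lt hp)) rw).
  by rewrite /pairing_sign /= oner_eq0.
rewrite -!(Fbr_weight_br hp); split; first by exists 3; case: len.
by split=> //; rewrite (Fbr_weight_br hp); apply: Der_complete.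
Qed.
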